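(* Let $n\ge 1$ and let $nK_4$ denote the disjoint union of $n$ copies of the complete graph $K_4$. Then $S(nK_4)=s$, where $s$ is the positive integer such that $$\binom{\lfloor\frac{s-1}{2}\rfloor}{3}+\binom{\lceil\frac{s-1}{2}\rceil}{3}<n\le\binom{\lfloor\frac{s}{2}\rfloor}{3}+\binom{\lceil\frac{s}{2}\rceil}{3}.$$
   Context: For a finite simple graph $G=(V,E)$ and an injective map $f:V\to\mathbb Z$, let $\sigma(G,f)=\{f(v)+f(w): vw\in E\}$. The sum index of $G$ is $S(G)=\min_{f}|\sigma(G,f)|$ over all injective $f:V\to\mathbb Z$. Binomial coefficients $\binom{a}{3}$ are $0$ when $a<3$. *)

(* Defs.v *)
From HB Require Import structures.
From mathcomp Require Import all_boot all_order all_algebra.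
From mathcomp Require Import finmap.
From mathcomp Require Import boolp.

Set Implicit Arguments.
Unset Strict Implicit.
Unset Printing Implicit Defensive.

Record sgraph := SGraph {
  vertex :> finType;
  adj : rel vertex;
  adj_sym : symmetric adj;
  adj_irrefl : irreflexive adj }.

Section CompleteGraph.
Variable m : nat.

Definition complete_adj : rel 'I_m := fun x y => x != y.

Lemma complete_adj_sym : symmetric complete_adj.
Proof. by move=> x y; rewrite /complete_adj eq_sym. Qed.

Lemma complete_adj_irrefl : irreflexive complete_adj.
Proof. by move=> x; rewrite /complete_adj eqxx. Qed.

Definition complete_graph : sgraph :=
  SGraph complete_adj_sym complete_adj_irrefl.
End CompleteGraph.

Section Copies.
Variables (n : nat) (G : sgraph).

Definition copies_adj : rel ('I_n * G)%type :=
  fun x y => (x.1 == y.1) && adj x.2 y.2.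

Lemma copies_adj_sym : symmetric copies_adj.
Proof. by move=> x y; rewrite /copies_adj eq_sym adj_sym. Qed.

Lemma copies_adj_irrefl : irreflexive copies_adj.
Proof. by move=> x; rewrite /copies_adj adj_irrefl andbF. Qed.

Definition copies : sgraph := SGraph copies_adj_sym copies_adj_irrefl.
End Copies.

Section SumIndex.
Variable G : sgraph.

Definition sum_set (f : G -> int) : {fset int} :=
  [fset (f p.1 + f p.2)%R | p in [pred p : G * G | adj p.1 p.2]]%fset.

Definition sum_set_size (k : nat) : Prop :=
  exists f : G -> int, injective f /\ #|` sum_set f| = k.

Lemma sum_set_size_exists : exists k, `[< sum_set_size k >].
Proof.
pose f (v : G) : int := Posz (enum_rank v).
exists #|` sum_set f|; apply/asboolP; exists f; split=> //.
by move=> x y [] /ord_inj /enum_rank_inj.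
Qed.

Definition sum_index : nat := ex_minn sum_set_size_exists.

Lemma sum_indexP (s : nat) :
  sum_index = s <->
  (exists f : G -> int, injective f /\ #|` sum_set f| = s) /\
  (forall f : G -> int, injective f -> s <= #|` sum_set f|).
Proof.
rewrite /sum_index; case: ex_minnP => m /asboolP[f [fi fm]] mmin; split.
- move=> <-; split; first by exists f.
  by move=> g gi; apply: mmin; apply/asboolP; exists g.
- case=> [[g [gi gs]] smin]; apply/eqP; rewrite eqn_leq -{2}fm smin // andbT.
  by apply: mmin; apply/asboolP; exists g.
Qed.
End SumIndex.

Lemma mem_sum_set (G : sgraph) (f : G -> int) (z : int) :
  reflect (exists v w : G, adj v w /\ z = (f v + f w)%R) (z \in sum_set f).
Proof.
apply: (iffP (imfsetP _ _ _ _)) => [[[v w] /= vw ->]|[v [w [vw ->]]]].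
- by exists v, w.
- by exists (v, w).
Qed.

(* Main.v *)
(** Lower bound: split the [s] edge sums into the [s./2] smallest and the
    [uphalf s] largest.  If a copy of K4 has labels a < b < c < d, then either
    b + c is a small sum, and so are all sums of the triangle abc, or b + c is a
    large sum, and so are all sums of the triangle bcd.  The three sums of a
    triangle determine its labels, hence the copy, so distinct copies yield
    distinct 3-subsets of one of the two halves.

    Construction: put y_0 = 0 and y_i = 5^i for i > 0.  For i < j < k the four
    labels ±y_i ± y_j ± y_k with a prescribed product of signs form a K4 whose
    edge sums are ±2y_i, ±2y_j, ±2y_k.  Each triple of indices gives two copies,
    one for each product of signs, except that only one is kept when i = 0; all
    labels are distinct by uniqueness of expansions in base 5 with digits in
    {-1, 0, 1}.  The index 0 is used exactly when [s] is odd. *)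

Require Import Defs.
From HB Require Import structures.
From mathcomp Require Import all_boot all_order all_algebra.
From mathcomp Require Import finmap.
From mathcomp Require Import boolp.
From mathcomp Require Import zify.

Import Order.TTheory GRing.Theory Num.Theory.

(** * Thresholds that determine [s] from [n] *)

Definition half_triples (s : nat) : nat := 'C(s./2, 3) + 'C(uphalf s, 3).

Lemma half_triples_mono s t : s <= t -> half_triples s <= half_triples t.
Proof. by move=> st; apply: leq_add; apply: leq_bin2l; lia. Qed.

(** Both halves equal [n + 2]; by Pascal's rule the step from [n] to [n + 1] adds ['C(n + 2, 2) > 0]
    to each binomial. *)
Lemma half_triples_unbounded n : n <= half_triples (n + 2).*2.
Proof.
rewrite /half_triples doubleK.
suff : n <= 'C(n + 2, 3) by lia.
elim: n => // n IH.
rewrite addSn binS.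
have : 0 < 'C(n + 2, 2) by rewrite bin_gt0; lia.
by lia.
Qed.

Lemma half_triples_interval_exists n : 0 < n ->
  exists s, 0 < s /\ half_triples (s - 1) < n <= half_triples s.
Proof.
move=> n_gt0; have ex : exists s, n <= half_triples s.
  by exists (n + 2).*2; exact: half_triples_unbounded.
case: (ex_minnP ex) => s ns smin; exists s.
have s_gt0 : 0 < s by case: s ns {smin} => //; rewrite leqNgt n_gt0.
split=> //; rewrite ns andbT ltnNge; apply/negP => /smin.
by lia.
Qed.

Lemma half_triples_interval_unique n s t : 0 < s -> 0 < t ->
  half_triples (s - 1) < n <= half_triples s ->
  half_triples (t - 1) < n <= half_triples t -> s = t.
Proof.
move=> s0 t0 /andP[s1 s2] /andP[t1 t2]; case: (ltngtP s t) => // lt.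
- have := @half_triples_mono s (t - 1); lia.
- have := @half_triples_mono t (s - 1); lia.
Qed.

(** * Lower bound: triangles whose sums lie in one half of the edge sums *)

Lemma lower_set_exists (T : finType) (g : T -> int) k : k <= #|T| ->
  exists2 L : {set T}, #|L| = k &
    forall x y, (g y < g x)%R -> x \in L -> y \in L.
Proof.
elim: k => [_|k IH lt_k].
  by exists set0; rewrite ?cards0 // => x y; rewrite !inE.
have [L cardL downL] := IH (ltnW lt_k).
have [x0 x0L] : exists x, x \notin L.
  apply/existsP; rewrite -negb_forall; apply/negP => /forallP allL.
  have LT : L = [set: T] by apply/setP => x; rewrite allL inE.
  by move: lt_k; rewrite -cardL LT cardsT ltnn.
(* Adding a minimiser of [g] off [L] preserves closure under smaller values. *)
pose m := [arg min_(x < x0 | x \notin L) g x]%O.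
have [mL m_min] : m \notin L /\ forall y, y \notin L -> (g m <= g y)%R.
  by rewrite /m; case: arg_minP.
exists (m |: L); first by rewrite cardsU1 mL cardL.
move=> x y lt_yx; rewrite !inE => /predU1P[xm|xL]; apply/orP; right.
  apply: contraTT lt_yx => /m_min; rewrite -xm => ?; lia.
exact: downL xL.
Qed.

Lemma sort4 (g : 'I_4 -> int) : injective g ->
  exists a b c d, [/\ (g a < g b)%R, (g b < g c)%R & (g c < g d)%R].
Proof.
move=> g_inj; pose r : rel 'I_4 := fun x y => (g x <= g y)%R.
have r_total : total r by move=> x y; exact: le_total.
have := sort_sorted r_total (enum 'I_4).
have : uniq (sort r (enum 'I_4)) by rewrite sort_uniq enum_uniq.
have : size (sort r (enum 'I_4)) = 4 by rewrite size_sort size_enum_ord.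
case: (sort r _) => [|a [|b [|c [|d [|]]]]] //= _ /and4P[].
rewrite !inE !negb_or => /and3P[ab _ _] /andP[bc _] cd _ /and4P[rab rbc rcd _].
exists a, b, c, d; rewrite !lt_neqAle !(inj_eq g_inj).
by split; apply/andP.
Qed.

Lemma adj_copies n (i : 'I_n) (v w : 'I_4) : v != w ->
  @adj (copies n (complete_graph 4)) (i, v) (i, w).
Proof. by move=> vw; rewrite /= /copies_adj /= eqxx. Qed.

(** Both triples of sums are strictly increasing, so the memberships force [x = x'], [y = y'] and
    [z = z']; then [2a = x + y - z]. *)
Lemma triangle_sums_inj (a b c a' b' c' x y z x' y' z' : int) :
  (a < b)%R -> (b < c)%R -> (a' < b')%R -> (b' < c')%R ->
  (x = a + b)%R -> (y = a + c)%R -> (z = b + c)%R ->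
  (x' = a' + b')%R -> (y' = a' + c')%R -> (z' = b' + c')%R ->
  x \in [:: x'; y'; z'] -> y \in [:: x'; y'; z'] -> z \in [:: x'; y'; z'] ->
  a = a'.
Proof.
rewrite !inE => ab bc ab' bc' hx hy hz hx' hy' hz'.
by move=> /or3P[] /eqP ? /or3P[] /eqP ? /or3P[] /eqP ?; lia.
Qed.

Lemma copies_le_half_triples n (f : copies n (complete_graph 4) -> int) :
  injective f -> n <= half_triples #|` sum_set f|.
Proof.
move=> f_inj; set S := sum_set f; pose T : finType := S.
have cardT : #|T| = #|` S| by rewrite -cardfE.
pose edge_sum i v w (x : T) := val x = (f (i, v) + f (i, w))%R.
have edgeE (i : 'I_n) (v w : 'I_4) : v != w -> exists x : T, edge_sum i v w x.
  move=> vw.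
  have S_vw : (f (i, v) + f (i, w))%R \in S.
    by apply/mem_sum_set; exists (i, v), (i, w); split=> //; exact: adj_copies.
  by exists [` S_vw]%fset.
have half_le : (#|` S|)./2 <= #|T| by rewrite cardT; lia.
have [L cardL downL] := @lower_set_exists T val _ half_le.
have cardLC : #|~: L| = uphalf #|` S|.
  by have := cardsC L; rewrite cardL cardT; lia.
(* Vertices are listed by increasing label, so that [triangle_sums_inj] recovers the least label
   from [A]. *)
pose triangle (i : 'I_n) (A : {set T}) := exists p q r x y z,
  [/\ (f (i, p) < f (i, q))%R, (f (i, q) < f (i, r))%R,
      [/\ edge_sum i p q x, edge_sum i p r y & edge_sum i q r z]
    & A = [set x; y; z]].
pose D (B : {set T}) := [set A : {set T} | A \subset B & #|A| == 3].
have card3 (x y z : T) : (val x < val y)%R -> (val y < val z)%R ->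
    #|[set x; y; z]| == 3.
  move=> xy yz; rewrite -setUA cardsU1 cards2 !inE negb_or -!val_eqE.
  have -> : val x != val y by lia.
  have -> : val x != val z by lia.
  by have -> : val y != val z by lia.
have exA i : exists A, A \in D L :|: D (~: L) /\ triangle i A.
  have fi_inj : injective (fun v => f (i, v)) by move=> v w /f_inj [].
  have [a [b [c [d [/= ab bc cd]]]]] := sort4 _ fi_inj.
  have neq v w : (f (i, v) < f (i, w))%R -> v != w.
    by apply: contraTneq => ->; rewrite ltxx.
  have [xab Hab] := edgeE i a b (neq _ _ ab).
  have [xac Hac] := edgeE i a c (neq _ _ (lt_trans ab bc)).
  have [xbc Hbc] := edgeE i b c (neq _ _ bc).
  have [xbd Hbd] := edgeE i b d (neq _ _ (lt_trans bc cd)).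
  have [xcd Hcd] := edgeE i c d (neq _ _ cd).
  have lt1 : (val xab < val xac)%R by rewrite Hab Hac ltrD2l.
  have lt2 : (val xac < val xbc)%R by rewrite Hac Hbc ltrD2r.
  have lt3 : (val xbc < val xbd)%R by rewrite Hbc Hbd ltrD2l.
  have lt4 : (val xbd < val xcd)%R by rewrite Hbd Hcd ltrD2r.
  case: (boolP (xbc \in L)) => bcL.
  - exists [set xab; xac; xbc]; split; last by exists a, b, c, xab, xac, xbc.
    rewrite !inE card3 // !andbT.
    apply/orP; left; apply/subsetP => x; rewrite !inE.
    by move=> /orP[/orP[]|] /eqP-> //; apply: downL bcL => //; exact: lt_trans lt2.
  - exists [set xbc; xbd; xcd]; split; last by exists b, c, d, xbc, xbd, xcd.
    rewrite !inE card3 // !andbT.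
    (* A sum above [xbc] that lay in [L] would put [xbc] in [L]. *)
    apply/orP; right; apply/subsetP => x; rewrite !inE.
    by move=> /orP[/orP[]|] /eqP-> //; apply: contra bcL; apply: downL => //;
      exact: lt_trans lt4.
have [A A_spec] := fin_all_exists exA.
have A_inj : injective A.
  move=> i j eqA.
  have [_ [p [q [r [x [y [z [pq qr [Hx Hy Hz] defA]]]]]]]] := A_spec i.
  have [_ [p' [q' [r' [x' [y' [z' [pq' qr' [Hx' Hy' Hz'] defA']]]]]]]] :=
    A_spec j.
  have mem u : u \in [set x; y; z] -> val u \in [:: val x'; val y'; val z'].
    by rewrite -defA eqA defA' !inE !val_eqE -orbA.
  (* Equal least labels belong to the same vertex, hence to the same copy. *)
  have /f_inj [] // : f (i, p) = f (j, p').
  by apply: (triangle_sums_inj _ _ _ _ _ _ _ _ _ _ _ _ pq qr pq' qr'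
    Hx Hy Hz Hx' Hy' Hz'); apply: mem; rewrite !inE eqxx ?orbT.
have : #|A @: 'I_n| <= #|D L :|: D (~: L)|.
  by apply: subset_leq_card; apply/subsetP => _ /imsetP[i _ ->]; case: (A_spec i).
rewrite card_imset // card_ord => /leq_trans; apply.
apply: leq_trans (leq_card_setU _ _) _.
by rewrite /half_triples !cards_draws cardL cardLC.
Qed.

(** * Construction: signed sums of powers of 5 as labels *)

Definition spread (i : nat) : int := if i is 0 then 0%R else Posz (5 ^ i).

Definition signed (b : bool) (x : int) : int := if b then (- x)%R else x.

(** If [k < k'], the left side is below [3/2 * 5^k <= 3/10 * 5^k'] in absolute value, the right side
    above [1/2 * 5^k']. If [k = k'], opposite signs would need [|r - r'| = 2 * 5^k]. *)
Lemma leading_term_inj (k k' : nat) (e e' : bool) (r r' : int) :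
  (`|r| * 2 < Posz (5 ^ k))%R -> (`|r'| * 2 < Posz (5 ^ k'))%R ->
  (r + signed e (Posz (5 ^ k)) = r' + signed e' (Posz (5 ^ k')))%R ->
  [/\ k = k', e = e' & r = r'].
Proof.
have pow_gap i j : i < j -> 5 ^ i * 5 <= 5 ^ j.
  by move=> ij; rewrite -expnSr leq_exp2l.
case: (ltngtP k k') => [/pow_gap|/pow_gap|->].
- by case: e; case: e' => /=; lia.
- by case: e; case: e' => /=; lia.
by case: e; case: e' => /= *; split=> //; lia.
Qed.

Lemma signed_spread_inj i j b c : signed b (spread i) = signed c (spread j) ->
  i = j /\ (0 < i -> b = c).
Proof.
have pow_gt0 k : 0 < 5 ^ k by rewrite expn_gt0.
case: i j => [|i] [|j] //=.
- by have := pow_gt0 j.+1; case: b; case: c => /=; lia.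
- by have := pow_gt0 i.+1; case: b; case: c => /=; lia.
move=> eq_ij; case: (@leading_term_inj i.+1 j.+1 b c 0 0) => //.
- by have := pow_gt0 i.+1; lia.
- by have := pow_gt0 j.+1; lia.
by rewrite !add0r.
Qed.

Record quad := Quad { q1 : nat; q2 : nat; q3 : nat; qtype : bool }.

(* The two bits of [v] are the signs of the two larger terms, [qtype] the
   product of the three signs. *)
Definition label (q : quad) (v : 'I_4) : int :=
  (signed (odd v (+) (1 < v)%N (+) qtype q) (spread (q1 q))
   + signed (odd v) (spread (q2 q)) + signed (1 < v)%N (spread (q3 q)))%R.

(** The bound [s./2] leaves room for the sums ±2y_i with [i > 0], and for 0 when [s] is odd. Since
    y_0 = 0, both types give the same labels at [q1 q = 0], so one type is fixed there. *)
Definition good_quad (s : nat) (q : quad) : Prop :=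
  [/\ q1 q < q2 q, q2 q < q3 q, q3 q <= s./2
    & q1 q = 0 -> odd s /\ ~~ qtype q].

Lemma ord4_bits_inj (v w : 'I_4) :
  odd v = odd w -> (1 < v) = (1 < w) -> v = w.
Proof.
move=> odd_vw gt_vw; apply: val_inj; move: odd_vw gt_vw => /=.
by case: v w => [[|[|[|[|?]]]] ?] [[|[|[|[|?]]]] ?].
Qed.

(** Peel off the terms of index [k], then [j]: with gaps of a factor 5, the rest stays below half
    the leading power. *)
Lemma label_inj s q q' v v' : good_quad s q -> good_quad s q' ->
  label q v = label q' v' -> q = q' /\ v = v'.
Proof.
case: q q' => [i j k t] [i' j' k' t'] [/= ij jk _ i0] [/= ij' jk' _ i0'].
rewrite /label /=.
have bound a : (0 <= spread a <= Posz (5 ^ a))%R by case: a => //= a; lia.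
have pow_gap a b : a < b -> 5 ^ a * 5 <= 5 ^ b.
  by move=> ab; rewrite -expnSr leq_exp2l.
have spreadE a b : a < b -> spread b = Posz (5 ^ b) by case: b.
rewrite (spreadE _ _ ij) (spreadE _ _ jk) (spreadE _ _ ij') (spreadE _ _ jk').
move: (pow_gap _ _ ij) (pow_gap _ _ jk) (pow_gap _ _ ij') (pow_gap _ _ jk').
move: (bound i) (bound i') => bi bi' gij gjk gij' gjk'.
have abs_signed b x : (0 <= x)%R -> (`|signed b x| = x)%R.
  by case: b => /=; lia.
set b1 := odd v (+) _ (+) _; set b1' := odd v' (+) _ (+) _.
have A := abs_signed b1 (spread i); have A' := abs_signed b1' (spread i').
have B := abs_signed (odd v) (Posz (5 ^ j)).
have B' := abs_signed (odd v') (Posz (5 ^ j')).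
case/leading_term_inj; [lia|lia|move=> <- ek].
case/leading_term_inj; [lia|lia|move=> <- ej e1].
have v_eq := ord4_bits_inj _ _ ej ek.
split=> //; have [i_eq b_eq] := signed_spread_inj _ _ _ _ e1.
(* For [i = 0] the type comes from [good_quad]; for [i > 0] it is read off from the sign of the
   smallest term. *)
rewrite -i_eq in i0' *; congr Quad; case: (posnP i) => [i_eq0|/b_eq].
  by have [_ /negbTE->] := i0 i_eq0; have [_ /negbTE->] := i0' i_eq0.
by rewrite /b1 /b1' v_eq => /addbI.
Qed.

(** * Edge sums of the construction *)

Definition double_spread_seq (s : nat) : seq int :=
  nseq (odd s) 0%R ++ [seq (spread i *+ 2)%R | i <- iota 1 s./2]
    ++ [seq (- (spread i *+ 2))%R | i <- iota 1 s./2].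

Lemma size_double_spread_seq s : size (double_spread_seq s) = s.
Proof. by rewrite !size_cat size_nseq !size_map size_iota; lia. Qed.

Lemma mem_double_spread_seq s i b : i <= s./2 -> (i = 0 -> odd s) ->
  signed b (spread i *+ 2)%R \in double_spread_seq s.
Proof.
move=> le_i i0; rewrite !mem_cat; case: (posnP i) => [i_eq0|i_gt0].
  by rewrite i0 // i_eq0 /= inE mul0rn; case: b.
have mem_i : i \in iota 1 s./2 by rewrite mem_iota; lia.
by case: b; apply/orP; right; apply/orP; [right|left]; apply/mapP; exists i.
Qed.

Lemma label_add s q v w : good_quad s q -> v != w ->
  (label q v + label q w)%R \in double_spread_seq s.
Proof.
case: q => i j k t [/= ij jk le_k i0] vw.
have mem b l : l \in [:: i; j; k] ->
    (label (Quad i j k t) v + label (Quad i j k t) w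
       = signed b (spread l *+ 2))%R ->
    (label (Quad i j k t) v + label (Quad i j k t) w)%R
       \in double_spread_seq s.
  rewrite !inE => l_in ->; apply: mem_double_spread_seq.
    by case/or3P: l_in => /eqP->; lia.
  by case/or3P: l_in => /eqP-> ?; [case: i0|lia|lia].
(* Equal products of signs make two distinct vertices differ in exactly two signs; those terms
   cancel, and the term [l] with common sign [b] is doubled. *)
pose l := if odd v == odd w then j else if (1 < v) == (1 < w) then k else i.
pose b := if odd v == odd w then odd v else if (1 < v) == (1 < w) then 1 < v
  else odd v (+) (1 < v) (+) t.
apply: (mem b l).
  by rewrite /l; do 2?case: ifP => _; rewrite !inE eqxx ?orbT.
rewrite {mem}/b {}/l /label /=.
case: v w vw => [[|[|[|[|?]]]] ?] [[|[|[|[|?]]]] ?] //= _;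
  by case: t {i0} => /=; lia.
Qed.

(** * Counting quads by increasing triples of indices *)

Definition sorted_triples (m : nat) : {set 3.-tuple 'I_m} :=
  [set t : 3.-tuple 'I_m | sorted ltn (map val t)].

(** The shift [d] is the first available index, 0 or 1. *)
Definition quad_of_triple m (d : nat) (b : bool) (t : 3.-tuple 'I_m) : quad :=
  let x i := (tnth t (inord i) : nat) + d in Quad (x 0) (x 1) (x 2) b.

Lemma quad_of_triple_inj m d b : injective (@quad_of_triple m d b).
Proof.
move=> t t' [/addIn e0 /addIn e1 /addIn e2]; apply: eq_from_tnth => i.
apply: val_inj; rewrite -(inord_val i).
by case: i => [[|[|[|?]]] ?].
Qed.

Lemma good_quad_of_triple s m d b (t : 3.-tuple 'I_m) :
  t \in sorted_triples m -> m + d <= (s./2).+1 ->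
  (d = 0 -> odd s /\ ~~ b) -> good_quad s (quad_of_triple m d b t).
Proof.
rewrite inE => t_sorted md d0.
have lt_x i j : i < j < 3 ->
    (tnth t (inord i) : nat) < tnth t (inord j).
  case/andP=> ij j3.
  have tE l : l < 3 -> (tnth t (inord l) : nat) = nth 0 (map val t) l.
    move=> l3; rewrite (tnth_nth (tnth t ord0)) inordK //.
    by rewrite (nth_map (tnth t ord0)) ?size_tuple.
  rewrite !tE //; last lia.
  by apply: (sorted_ltn_nth ltn_trans) => //; rewrite inE size_map size_tuple; lia.
have := lt_x 0 1 isT; have := lt_x 1 2 isT.
have := ltn_ord (tnth t (inord 2)).
by rewrite /good_quad /= => ? ? ?; split; try lia.
Qed.

Lemma good_quads_exist n s : n <= half_triples s ->
  exists2 Q : 'I_n -> quad, injective Q & forall i, good_quad s (Q i).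
Proof.
move=> n_le.
pose X : finType :=
  ({t | t \in sorted_triples (s./2)} + {t | t \in sorted_triples (uphalf s)})%type.
have cardX : #|X| = half_triples s.
  by rewrite card_sum !card_sig !card_ltn_sorted_tuples.
(* Type [true] uses the indices from 1 to [s./2]. Type [false] also uses 0 when [s] is odd, which
   makes [uphalf s] indices in either parity. *)
pose F (x : X) : quad := match x with
  | inl t => quad_of_triple _ 1 true (val t)
  | inr t => quad_of_triple _ (~~ odd s) false (val t) end.
have F_inj : injective F.
  case=> [t|t] [t'|t'] //.
  - by move/quad_of_triple_inj/val_inj->.
  - by move/quad_of_triple_inj/val_inj->.
have F_good x : good_quad s (F x).
  by case: x => [[t ts]|[t ts]] /=; apply: good_quad_of_triple => //; try lia.
rewrite -cardX in n_le.
exists (fun i => F (enum_val (widen_ord n_le i))) => [i j|i]; last exact: F_good.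
by move/F_inj/enum_val_inj => [] /ord_inj.
Qed.

(** * Upper bound and value of the sum index *)

Lemma labeling_exists n s : n <= half_triples s ->
  exists2 f : copies n (complete_graph 4) -> int,
    injective f & #|` sum_set f| <= s.
Proof.
case/good_quads_exist=> Q Q_inj Q_good.
exists (fun v => label (Q v.1) v.2).
  by move=> [i v] [j w] /= /(label_inj _ _ _ _ _ (Q_good i) (Q_good j)) [/Q_inj-> ->].
(* The edge sums all lie in a list of length [s], which bounds their number. *)
rewrite -[leqRHS]size_double_spread_seq.
apply: uniq_leq_size; first exact: fset_uniq.
move=> z /mem_sum_set [[i v] [[j w] [/= /andP[/= /eqP <- vw] ->]]].
exact: label_add vw.
Qed.

Theorem theorem2p6 (n : nat) (hn : 1 <= n) :
  (exists! s : nat, 0 < s /\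
     'C((s - 1)./2, 3) + 'C(uphalf (s - 1), 3) < n <= 'C(s./2, 3) + 'C(uphalf s, 3)) /\
  (forall s : nat, 0 < s ->
     'C((s - 1)./2, 3) + 'C(uphalf (s - 1), 3) < n <= 'C(s./2, 3) + 'C(uphalf s, 3) ->
     sum_index (copies n (complete_graph 4)) = s).
Proof.
split.
  have [s [s_gt0 s_int]] := half_triples_interval_exists n hn.
  exists s; split=> // t [t_gt0 t_int].
  exact: half_triples_interval_unique s_gt0 t_gt0 s_int t_int.
move=> s s_gt0 /andP[lt_n le_n]; apply/sum_indexP.
have s_min (f : copies n (complete_graph 4) -> int) :
    injective f -> s <= #|` sum_set f|.
  move/copies_le_half_triples => n_le; rewrite leqNgt; apply/negP => lt_s.
  (* With fewer than [s] sums, monotonicity would give [n <= half_triples (s - 1)]. *)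
  have : half_triples #|` sum_set f| <= half_triples (s - 1).
    by apply: half_triples_mono; lia.
  by move: lt_n n_le; rewrite /half_triples; lia.
have [f f_inj f_le] := labeling_exists n s le_n.
split=> //; exists f; split=> //.
by apply/eqP; rewrite eqn_leq f_le s_min.
Qed.
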